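(* Let $R$ be a multiplicative hyperring and let $I$ be a proper hyperideal of $R$. Then the following statements are equivalent: (i) $I$ is a $J$-prime hyperideal of $R$. (ii) $I=(I:x)$ for every $x\in R$ with $x\notin J(R)$. (iii) For all hyperideals $I_1$ and $I_2$ of $R$, $I_1\circ I_2\subseteq I$ implies $I_1\subseteq J(R)$ or $I_2\subseteq I$.
   Context: A multiplicative hyperring is a nonempty set $R$ with an operation $+$ and a hyperoperation $\circ: R\times R\to P^*(R)$ (where $P^*(R)$ is the set of nonempty subsets of $R$) such that: $(R,+)$ is an abelian group; $\circ$ is associative; $a\circ(b+c)\subseteq a\circ b+a\circ c$ and $(b+c)\circ a\subseteq b\circ a+c\circ a$; and $a\circ(-b)=(-a)\circ b=-(a\circ b)$ for all $a,b,c\in R$. For nonempty subsets $A,B\subseteq R$, $A\circ B=\bigcup_{x\in A,\,y\in B}x\circ y$, and $A\circ r=A\circ\{r\}$. Standing assumptions: $R$ is commutative with an identity $1$, meaning $a\in a\circ 1$ for all $a\in R$. A hyperideal of $R$ is a nonempty subset $I\subseteq R$ with $a-b\in I$ for $a,b\in I$ and $r\circ x\subseteq I$ for $x\in I$, $r\in R$. Let $\mathbf{C}=\{r_1\circ r_2\circ\cdots\circ r_n : r_i\in R,\ n\in\mathbb{N}\}$; a hyperideal $I$ is a $\mathbf{C}$-hyperideal if for every $A\in\mathbf{C}$, $A\cap I\neq\varnothing$ implies $A\subseteq I$. Standing assumption: all hyperideals are $\mathbf{C}$-hyperideals. A proper hyperideal $M$ is maximal if every hyperideal $N$ with $M\subsetneq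 N\subseteq R$ equals $R$; the Jacobson radical $J(R)$ is the intersection of all maximal hyperideals of $R$. For $x\in R$, $(I:x)=\{r\in R : r\circ x\subseteq I\}$. A proper hyperideal $I$ is $J$-prime if for all $x,y\in R$, $x\circ y\subseteq I$ implies $x\in J(R)$ or $y\in I$. *)

(* Defs.v *)
From HB Require Import structures.
From mathcomp Require Import all_boot all_algebra.
From mathcomp Require Import boolp classical_sets.

Set Implicit Arguments.
Unset Strict Implicit.
Unset Printing Implicit Defensive.

Import GRing.Theory.

Local Open Scope classical_set_scope.
Local Open Scope ring_scope.

Definition setprod_of (T : Type) (op : T -> T -> set T) (A B : set T) : set T :=
  \bigcup_(x in A) \bigcup_(y in B) op x y.

(* Distributivity is only an inclusion, and the unit law (below) only a
   membership. *)
HB.mixin Record Zmodule_isMulHyperRing R & GRing.Zmodule R := {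
  hmul : R -> R -> set R;
  hmul_neq0 : forall a b, hmul a b !=set0;
  hmulA : forall a b c,
    setprod_of hmul [set a] (hmul b c) = setprod_of hmul (hmul a b) [set c];
  hmulDr : forall a b c,
    hmul a (b + c) `<=` [set u + v | u in hmul a b & v in hmul a c];
  hmulDl : forall a b c,
    hmul (b + c) a `<=` [set u + v | u in hmul b a & v in hmul c a];
  hmulrN : forall a b, hmul a (- b) = [set - u | u in hmul a b];
  hmulNr : forall a b, hmul (- a) b = [set - u | u in hmul a b]
}.

#[short(type="mulHyperRingType")]
HB.structure Definition MulHyperRing :=
  { R of GRing.Zmodule R & Zmodule_isMulHyperRing R }.

HB.mixin Record MulHyperRing_isCom R & MulHyperRing R := {
  hone : R;
  hmulC : forall a b : R, hmul a b = hmul b a;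
  in_hmulr1 : forall a : R, hmul a hone a
}.

#[short(type="comMulHyperRingType")]
HB.structure Definition ComMulHyperRing :=
  { R of MulHyperRing R & MulHyperRing_isCom R }.

Definition set_hmul (R : mulHyperRingType) (A B : set R) : set R :=
  setprod_of (@hmul R) A B.

Notation "a \h* b" := (hmul a b) (at level 40, left associativity).
Notation "A \H* B" := (set_hmul A B) (at level 40, left associativity).

Section Hyperideals.
Variable R : comMulHyperRingType.
Implicit Types (I M N K : set R) (x y r : R).

Definition hyperideal I : Prop :=
  [/\ I !=set0,
      forall a b, I a -> I b -> I (a - b)
    & forall r x, I x -> r \h* x `<=` I].

Definition proper_hyperideal I : Prop := hyperideal I /\ I <> setT.

(* [finite_hprod r s] is r o s_0 o s_1 o ..., so that all products have at
   least one factor; the product of the single factor r is {r}. *)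
Definition finite_hprod r (s : seq R) : set R :=
  foldl (fun A t => A \H* [set t]) [set r] s.

Definition finite_hprods : set (set R) :=
  [set A | exists r s, A = finite_hprod r s].

Definition C_hyperideal I : Prop :=
  hyperideal I /\
  forall A, finite_hprods A -> A `&` I !=set0 -> A `<=` I.

Definition maximal_hyperideal M : Prop :=
  proper_hyperideal M /\
  forall N, hyperideal N -> M `<` N -> N = setT.

Definition Jacobson : set R :=
  \bigcap_(M in [set M | maximal_hyperideal M]) M.

Definition hresidual I x : set R := [set r | r \h* x `<=` I].

Definition J_prime I : Prop :=
  proper_hyperideal I /\
  forall x y, x \h* y `<=` I -> Jacobson x \/ I y.

End Hyperideals.

Arguments Jacobson R : clear implicits.

(* Main.v *)
Require Import Defs.
From mathcomp Require Import all_boot all_algebra.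
From mathcomp Require Import boolp classical_sets.

Local Open Scope classical_set_scope.

(** The step from J-primeness to residuals, and the step from residuals to
    products of hyperideals, only unfold the definitions: if [I1] has an element
    [x] outside the Jacobson radical, then every [y] in [I2] lies in the
    residual of [I] by [x], which is [I].

    Returning from hyperideals to elements, suppose that [x \h* y] lies in [I].
    Instead of the hyperideals generated by [x] and [y], whose product would
    have to be computed, take the largest hyperideals that serve: [I1], the
    annihilator of [y] modulo [I], and [I2], the annihilator of [I1] modulo
    [I].  Then [x] is in [I1], [y] is in [I2] by commutativity, and
    [I1 \H* I2] lies in [I] by construction.  It remains to know that
    annihilators modulo [I] are hyperideals ([hyperideal_hcolon]), where the
    inclusion form of distributivity suffices. *)

Section Colon.
Variable R : comMulHyperRingType.
Implicit Types (I A : set R) (x y r s : R).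
Import GRing.Theory.
Local Open Scope ring_scope.

Definition hcolon I A : set R := [set s | forall r, A r -> r \h* s `<=` I].

Lemma hyperideal0 I : hyperideal I -> I 0.
Proof. by case=> -[a Ia] IB _; rewrite -(subrr a); apply: IB. Qed.

Lemma hyperidealMl I x r : hyperideal I -> I x -> x \h* r `<=` I.
Proof. by case=> _ _ IM Ix; rewrite hmulC; apply: IM. Qed.

(** Since [r \h* (a - b)] only embeds in [r \h* a - r \h* b], closure under
    subtraction uses distributivity in the direction available.  Absorption is
    associativity, once [t \h* s] is turned into [s \h* t]. *)
Lemma hyperideal_hcolon I A : hyperideal I -> hyperideal (hcolon I A).
Proof.
move=> hI; have [_ IB IM] := hI; split.
- by exists 0 => r _; apply: IM; apply: hyperideal0.
- move=> a b ha hb r Ar z /hmulDr [u ru] [v].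
  rewrite hmulrN => -[w rw <-] <-.
  by apply: IB; [apply: ha ru | apply: hb rw].
- move=> t s hs u tsu r Ar z ruz.
  have: setprod_of (@hmul R) [set r] (s \h* t) z.
    by exists r => //; exists u => //; rewrite hmulC.
  rewrite hmulA => -[v rsv [_ -> vtz]].
  exact: (@hyperidealMl I v t hI (hs r Ar v rsv)).
Qed.

Lemma set_hmul_hcolon I A : A \H* hcolon I A `<=` I.
Proof. by move=> z [r Ar [s hs rsz]]; apply: hs Ar z rsz. Qed.

Lemma sub_hresidual I x : hyperideal I -> I `<=` hresidual I x.
Proof. by move=> hI r Ir; apply: hyperidealMl. Qed.

End Colon.

Theorem theorem3p11 (R : comMulHyperRingType)
    (allC : forall K : set R, hyperideal K -> C_hyperideal K)
    (I : set R) (properI : proper_hyperideal I) :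
  [<-> J_prime I;
       forall x : R, ~ Jacobson R x -> I = hresidual I x;
       forall I1 I2 : set R, hyperideal I1 -> hyperideal I2 ->
         I1 \H* I2 `<=` I -> I1 `<=` Jacobson R \/ I2 `<=` I].
Proof.
have [hI _] := properI; tfae.
- move=> [_ Jp] x nJx; apply/seteqP; split; first exact: sub_hresidual.
  move=> r; rewrite /hresidual /= hmulC => xrI.
  by case: (Jp _ _ xrI).
- move=> Ires I1 I2 _ _ I12.
  have [|/existsNP[x /not_implyP[I1x nJx]]] := pselect (I1 `<=` Jacobson R).
    by left.
  right=> y I2y; rewrite (Ires x nJx) /hresidual /= hmulC => z xyz.
  by apply: I12; exists x => //; exists y.
- move=> prodI; split=> // x y xyI.
  pose I1 := hcolon R I [set y]; pose I2 := hcolon R I I1.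
  have I1x : I1 x by move=> _ ->; rewrite hmulC.
  have I2y : I2 y by move=> r /(_ y erefl); rewrite hmulC.
  have [I1J|I2I] : I1 `<=` Jacobson R \/ I2 `<=` I.
    apply: prodI; [exact: hyperideal_hcolon.. | exact: set_hmul_hcolon].
  + by left; apply: I1J.
  + by right; apply: I2I.
Qed.
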